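(* Let $s\ge 0$ be an integer, let $k_0,k_1,\dots,k_s\ge 0$, $l_0\ge 0$ and $l_{s+1}\ge 2$ be integers, and let $\mathcal C$ be the geometric class with code $$\mathrm G^{l_{s+1}}\,\mathrm S\,\mathrm T^{k_s}\,\mathrm S\,\mathrm T^{k_{s-1}}\cdots \mathrm S\,\mathrm T^{k_1}\,\mathrm S\,\mathrm T^{k_0}\,\mathrm G^{l_0}$$ (that is, a code with exactly $s+1$ letters $\mathrm S$ and with $l_1=l_2=\dots=l_s=0$, where $l_i$ is the number of letters $\mathrm G$ in the block $\mathrm S\,\mathrm T^{k_i}\,\mathrm G^{l_i}$ started by the $(i+1)$-st letter $\mathrm S$ counted from the right). Define $$A_0=1,\qquad A_1=2+k_0,\qquad A_j=A_{j-2}+(1+k_{j-1})A_{j-1}\quad\text{for } 2\le j\le s+1 .$$ Then the derived vector $\mathrm{der}(\mathcal C)$ is non-decreasing, and exactly the following $s+2$ different values appear in it, in growing order: $A_0<A_1<\dots<A_{s+1}$. Their multiplicities are as follows: - $A_0$ appears $2+k_0+l_0$ times in a row; - for $1\le j\le s$, $A_j$ appears $1+k_j$ times in a row; - $A_{s+1}$ appears $l_{s+1}-1$ times in a row.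
   Context: A word of length $r\ge 2$ over the alphabet $\{\mathrm G,\mathrm S,\mathrm T\}$ is called admissible if it starts with $\mathrm{GG}$ and does not contain $\mathrm{GT}$ as two consecutive letters. Exponents denote repetition of letters. Admissible words of length $r$ are the codes of the geometric classes of germs of Goursat flags of length $r$ (rank-2 Goursat distributions of corank $r$ on manifolds of dimension $r+2$). A geometric class is identified with its code. The small growth vector of a distribution $D$ at a point $p$ is the sequence of dimensions $\dim V_j(p)$, where $V_1=D$ and $V_{j+1}=V_j+[D,V_j]$. It depends only on the geometric class $\mathcal C$ of the Goursat germ. It starts with $2$, takes all integer values up to $r+2$, and ends with $r+2$. The derived vector of a class $\mathcal C$ of length $r$ is the function $\mathrm{der}(\mathcal C):\{2,3,\dots,r+1\}\to\mathbb N$, written as the finite sequence of its values, where $\mathrm{der}(\mathcal C)(j)$ is the multiplicity of $j$ in the small growth vector of $\mathcal C$. By a known theorem of Jean, which can be taken here as the definition of $\mathrm{der}(\mathcal C)$, one has $\mathrm{der}(\mathcal C)=d^{\,r}$, where the functions $d^{\,j}:\{2,\dots,j+1\}\to\mathbb N$ are given by $d^{\,1}=(1)$, $d^{\,2}=(1,1)$ and, for $1\le j\le r-2$, $d^{\,j+2}=\mathrm G(d^{\,j+1})$, $\mathrm S(d^{\,j},d^{\,j+1})$ or $\mathrm T(d^{\,j},d^{\,j+1})$ according to whether the $(j+2)$-nd letter of the code is $\mathrm G$, $\mathrm S$ or $\mathrm T$. The operations are defined as follows. If $\beta=(\beta(2),\dots,\beta(m+1))$ is a sequence of length $m$ indexed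 from $2$, then $\mathrm G(\beta)=(1,\beta(2),\dots,\beta(m+1))$. If moreover $\alpha=(\alpha(2),\dots,\alpha(m))$ has length $m-1$, then $\mathrm S(\alpha,\beta)$ and $\mathrm T(\alpha,\beta)$ have length $m+1$ and are $$\mathrm S(\alpha,\beta)=(1,1,\alpha(2)+\beta(3),\alpha(3)+\beta(4),\dots,\alpha(m)+\beta(m+1)),$$ $$\mathrm T(\alpha,\beta)=(1,1,2\beta(3)-\alpha(2),2\beta(4)-\alpha(3),\dots,2\beta(m+1)-\alpha(m)).$$ *)

(* Defs.v *)
From HB Require Import structures.
From mathcomp Require Import all_boot all_order all_algebra.
Set Implicit Arguments.
Unset Strict Implicit.
Unset Printing Implicit Defensive.
Import Order.TTheory GRing.Theory Num.Theory.
Local Open Scope ring_scope.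

Inductive letter := LG | LS | LT.

Definition letter_code (x : letter) : option bool :=
  match x with LG => None | LS => Some true | LT => Some false end.
Definition letter_decode (o : option bool) : letter :=
  match o with None => LG | Some true => LS | Some false => LT end.
Lemma letter_codeK : cancel letter_code letter_decode.
Proof. by case. Qed.
HB.instance Definition _ := Equality.copy letter (can_type letter_codeK).

Definition admissible (w : seq letter) : bool :=
  prefix [:: LG; LG] w && ~~ infix [:: LG; LT] w.

(* Geometric classes of Goursat germs, identified with their codes; the length
   r of a class is the size of its code. *)
Definition geometric_class : Type := {w : seq letter | admissible w}.

(* A function on {2, ..., m+1} is written as the sequence of its m values, so
   position i of the sequence holds the value at i+2.  Values are taken in int,
   so that the subtraction in [opT] is not truncated. *)
Definition opG (b : seq int) : seq int := 1 :: b.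
Definition opS (a b : seq int) : seq int :=
  [:: 1, 1 & [seq p.1 + p.2 | p <- zip a (behead b)]].
Definition opT (a b : seq int) : seq int :=
  [:: 1, 1 & [seq 2 * p.2 - p.1 | p <- zip a (behead b)]].

Definition letter_op (x : letter) (a b : seq int) : seq int :=
  match x with LG => opG b | LS => opS a b | LT => opT a b end.

(* [dvec w j] is d^j for 1 <= j <= size w (the value at 0 is a dummy).  Letters
   are numbered from 1, so the (i+2)-nd letter of w is [nth LG w i.+1]. *)
Fixpoint dvec (w : seq letter) (j : nat) : seq int :=
  match j with
  | 0 => [::]
  | 1 => [:: 1]
  | 2 => [:: 1; 1]
  | (i.+1 as i1).+1 => letter_op (nth LG w i1) (dvec w i) (dvec w i1)
  end.

(* The multiplicities of 2, ..., r+1 in the small growth vector, given by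
   Jean's recursion. *)
Definition der (C : geometric_class) : seq int := dvec (val C) (size (val C)).

(* G^l S T^(k s) S T^(k (s-1)) ... S T^(k 0) G^l0 *)
Definition code_word (s : nat) (k : nat -> nat) (l0 l : nat) : seq letter :=
  nseq l LG ++ flatten [seq LS :: nseq (k i) LT | i <- rev (iota 0 s.+1)]
    ++ nseq l0 LG.

Fixpoint Aseq (k : nat -> nat) (j : nat) : nat :=
  match j with
  | 0 => 1
  | 1 => 2 + k 0
  | (i.+1 as i1).+1 => Aseq k i + (1 + k i1) * Aseq k i1
  end%N.

Definition appears_in_a_row (x : int) (n : nat) (d : seq int) : Prop :=
  count_mem x d = n /\ infix (nseq n x) d.

(* Main.v *)
(** Consecutive derived vectors have the form [(a, 1 :: b)] with [a] and [b] of
    equal length. In terms of the sequence of pairs [zip a b], a letter of the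
    code acts by one linear map on all pairs and then adds the pair [(1, 1)] in
    front. Hence S T^t acts by [(x, y) |-> (t x + y, (t + 1) x + y)] and adds
    [t + 1] pairs [(1, 1)]. Under the composite of these maps for
    k_{n-1}, ..., k_0 the second component becomes
    [(A_n - A_{n-1}) x + A_{n-1} y], which is [A_n] at [(1, 1)]; so the pairs
    added by S T^{k_n} end up with the value [A_n]. *)
Require Import Defs.
From HB Require Import structures.
From mathcomp Require Import all_boot all_order all_algebra.
From mathcomp Require Import zify ring.
Set Implicit Arguments.
Unset Strict Implicit.
Unset Printing Implicit Defensive.
Import Order.TTheory GRing.Theory Num.Theory.
Local Open Scope ring_scope.

Definition letter_map (x : letter) (p : int * int) : int * int :=
  match x with
  | LG => (p.2, p.2)
  | LS => (p.2, p.1 + p.2)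
  | LT => (p.2, 2 * p.2 - p.1)
  end.

Definition pair_step (L : seq (int * int)) (x : letter) : seq (int * int) :=
  (1, 1) :: map (letter_map x) L.

(** S and T combine the earlier vector with the later one stripped of its leading 1; so the zipped
    pairs are aligned and each letter acts pair by pair. *)
Lemma letter_op_unzip x (L : seq (int * int)) :
  letter_op x (unzip1 L) (1 :: unzip2 L) = 1 :: unzip2 (pair_step L x).
Proof.
by case: x; rewrite /= /opG /opS /opT /= ?zip_unzip /unzip2 -!map_comp.
Qed.

Lemma unzip1_pair_step x L : unzip1 (pair_step L x) = 1 :: unzip2 L.
Proof. by rewrite /= /unzip1 /unzip2 -map_comp; case: x. Qed.

(** The first two letters only account for d^1 = (1) and d^2 = (1, 1), encoded by [[:: (1, 1)]]; the
    fold reads the letters after them. Two consecutive vectors are tracked because the recursion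
    looks two steps back. *)
Lemma dvec_foldl w n : (n.+2 <= size w)%N ->
  dvec w n.+1 = unzip1 (foldl pair_step [:: (1, 1)] (take n (drop 2 w))) /\
  dvec w n.+2 = 1 :: unzip2 (foldl pair_step [:: (1, 1)] (take n (drop 2 w))).
Proof.
elim: n => [|n IH] ltnw; first by rewrite take0.
have [dn1 dn2] := IH (ltnW ltnw).
rewrite (take_nth LG) ?size_drop; last by lia.
rewrite foldl_rcons nth_drop add2n.
set L := foldl _ _ _ in dn1 dn2 *; split.
  by rewrite dn2 unzip1_pair_step.
by rewrite -letter_op_unzip -dn1 -dn2.
Qed.

Lemma rcons_nseq (T : Type) n (x : T) : rcons (nseq n x) x = nseq n.+1 x.
Proof. by rewrite -cats1 -[[:: x]]/(nseq 1 x) -nseqD addn1. Qed.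

Lemma foldl_nseqG n L :
  unzip2 (foldl pair_step L (nseq n LG)) = nseq n 1 ++ unzip2 L.
Proof.
elim: n L => //= n IH L; rewrite IH /= /unzip2 -map_comp.
by rewrite -cat_rcons rcons_nseq.
Qed.

Lemma foldl_nseqG_1 n m :
  foldl pair_step (nseq m (1, 1)) (nseq n LG) = nseq (n + m) (1, 1).
Proof.
elim: n m => //= n IH m.
by rewrite /pair_step map_nseq (IH m.+1) addnS.
Qed.

Definition block_map (t : nat) (p : int * int) : int * int :=
  (t%:Z * p.1 + p.2, t.+1%:Z * p.1 + p.2).

(** S sends (x, y) to (y, x + y), a pair with difference x. T moves a pair one step along its
    arithmetic progression, keeping the difference, and fixes (1, 1). *)
Lemma foldl_block t L :
  foldl pair_step L (LS :: nseq t LT) = nseq t.+1 (1, 1) ++ map (block_map t) L.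
Proof.
elim: t => [|t IH].
  by rewrite /= /pair_step; congr cons; apply: eq_map => -[x y];
     rewrite /block_map /=; congr pair; ring.
rewrite -rcons_nseq -rcons_cons foldl_rcons IH /pair_step.
rewrite map_cat map_nseq -map_comp /=; do 2!congr cons; congr cat.
by apply: eq_map => -[x y]; rewrite /block_map /=; congr pair; lia.
Qed.

(* At [n = 0], [n.-1 = 0] makes the linear form the second projection. *)
Lemma foldl_blocks k n L :
  unzip2 (foldl pair_step L
            (flatten [seq LS :: nseq (k i) LT | i <- rev (iota 0 n)])) =
  flatten [seq nseq (k j).+1 (Aseq k j)%:Z | j <- iota 0 n] ++
  [seq ((Aseq k n)%:Z - (Aseq k n.-1)%:Z) * p.1 + (Aseq k n.-1)%:Z * p.2
     | p <- L].
Proof.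
elim: n L => [|n IH] L.
  by apply: eq_map => -[x y] /=; ring.
have iotaSr : iota 0 n.+1 = rcons (iota 0 n) n by rewrite -addn1 iotaD cats1.
(* The block of index [n] is read first, but its run of A_n comes last in the result; the induction
   hypothesis is applied to the list that this block produces. *)
rewrite iotaSr rev_rcons map_rcons flatten_rcons -catA map_cons.
rewrite -[flatten (_ :: _)]/(_ ++ flatten _) foldl_cat foldl_block IH.
congr cat; rewrite map_cat map_nseq -map_comp /=.
have -> : ((Aseq k n)%:Z - (Aseq k n.-1)%:Z) * 1 + (Aseq k n.-1)%:Z * 1 =
  (Aseq k n)%:Z by ring.
congr (_ :: _ ++ _); apply: eq_map => -[x y] /=.
(* The coefficients of x agree by A_{n+1} = A_{n-1} + (1 + k_n) A_n. With A_0 in place of A_{n-1}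
   this also holds at n = 0, since A_1 = 2 + k_0. *)
case: n {IH iotaSr} => [|n] /=; lia.
Qed.

Lemma Aseq_gt0 k j : (0 < Aseq k j)%N.
Proof.
by have [] : (0 < Aseq k j)%N /\ (0 < Aseq k j.+1)%N by elim: j => //= j; lia.
Qed.

Lemma Aseq_ltS k j : (Aseq k j < Aseq k j.+1)%N.
Proof. by case: j => [|j] //=; have := Aseq_gt0 k j; nia. Qed.

Lemma Aseq_lt k : {homo Aseq k : i j / (i < j)%N}.
Proof. by apply: homo_ltn; [exact: ltn_trans | exact: Aseq_ltS]. Qed.

Section Runs.
Variables (v : nat -> int) (c : nat -> nat).
Hypothesis v_lt : {homo v : i j / (i < j)%N >-> i < j}.

(** The shape claimed for the derived vector, with abstract values and run lengths; a run may be
    empty here. *)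
Definition runs (m n : nat) : seq int :=
  flatten [seq nseq (c j) (v j) | j <- iota m n].

Lemma mem_runs m n x :
  reflect (exists2 j, (m <= j < m + n)%N & (0 < c j)%N /\ x = v j)
          (x \in runs m n).
Proof.
apply: (iffP flatten_mapP) => -[j].
  rewrite mem_iota mem_nseq => jP /andP[cj /eqP ->]; by exists j.
by move=> jP [cj ->]; exists j; rewrite ?mem_iota // mem_nseq cj eqxx.
Qed.

Lemma sorted_runs m n : sorted <=%R (runs m n).
Proof.
elim: n m => //= n IH m; rewrite /runs /= -/(runs m.+1 n).
rewrite sorted_pairwise ?pairwise_cat; last exact: le_trans.
rewrite -!sorted_pairwise; try exact: le_trans.
rewrite IH andbT; apply/andP; split.
  apply/allrelP => x y; rewrite mem_nseq => /andP[_ /eqP ->].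
  by case/mem_runs => j /andP[ltmj _] [_ ->]; apply/ltW/v_lt.
by elim: (c m) => //= -[|p] //=; rewrite lexx.
Qed.

Lemma runs_in_a_row n j : (j < n)%N -> appears_in_a_row (v j) (c j) (runs 0 n).
Proof.
move=> ltjn.
(* Split around run [j]: by strict monotonicity of [v], its value occurs neither before nor
   after. *)
have -> : runs 0 n = runs 0 j ++ nseq (c j) (v j) ++ runs j.+1 (n - j.+1).
  rewrite -[nseq _ _ ++ _]/(runs j (n - j.+1).+1) /runs -flatten_cat -map_cat.
  rewrite -[in iota j _](add0n j) -iotaD.
  by congr (flatten (map _ (iota _ _))); lia.
split; last by apply/infixP; exists (runs 0 j), (runs j.+1 (n - j.+1)).
rewrite !count_cat count_nseq /= eqxx mul1n.
have -> : count_mem (v j) (runs 0 j) = 0%N.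
  apply/count_memPn/negP => /mem_runs[i /andP[_ ltij] [_ eqv]].
  by have := v_lt ltij; rewrite eqv ltxx.
have -> : count_mem (v j) (runs j.+1 (n - j.+1)) = 0%N.
  apply/count_memPn/negP => /mem_runs[i /andP[ltji _] [_ eqv]].
  by have := v_lt ltji; rewrite eqv ltxx.
by rewrite addn0.
Qed.

End Runs.

Lemma der_code_word s k l0 l (C : geometric_class) (c : nat -> nat) :
  (2 <= l)%N -> val C = code_word s k l0 l ->
  c 0 = (2 + k 0 + l0)%N -> (forall j, (1 <= j <= s)%N -> c j = (1 + k j)%N) ->
  c s.+1 = (l - 1)%N ->
  der C = runs (fun j => (Aseq k j)%:Z) c 0 s.+2.
Proof.
case: l => [|[|l]] // _ eC c0 c_mid c_last; rewrite /der eC.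
set w := code_word _ _ _ _.
set u := nseq l LG ++
  flatten [seq LS :: nseq (k i) LT | i <- rev (iota 0 s.+1)] ++ nseq l0 LG.
have [_] := @dvec_foldl w (size u) (leqnn _).
have -> : drop 2 w = u by exact: drop0.
rewrite take_size -[size w]/(size u).+2 => ->.
(* Here [l] is two less than the number of leading letters G. With the initial pair they leave
   [l + 1] copies of (1, 1), which the blocks turn into the run of A_{s+1}. *)
rewrite !foldl_cat (foldl_nseqG_1 l 1) foldl_nseqG foldl_blocks map_nseq.
have flatten_cons (x : seq int) ss : flatten (x :: ss) = x ++ flatten ss by [].
rewrite /runs -[in RHS](addn1 s.+1) iotaD add0n map_cat flatten_cat.
rewrite -[iota 0 s.+1]/(0%N :: iota 1 s) -[iota s.+1 1]/[:: s.+1] !map_cons.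
rewrite !flatten_cons cats0 c0 c_last addn1 subSS subn0.
(* The run of A_0 = 1 merges the leading 1, the [l0] ones from the final letters G and the [k 0 + 1]
   ones from the last block. *)
have -> : (2 + k 0 + l0 = l0.+1 + (k 0).+1)%N by lia.
rewrite nseqD -!catA -cat_cons; congr (_ ++ (_ ++ (_ ++ _))); last first.
  by congr nseq; rewrite /fst /snd; ring.
congr flatten; apply/eq_in_map => j; rewrite mem_iota add1n ltnS => jP.
by rewrite c_mid.
Qed.

Theorem theorem2 (s : nat) (k : nat -> nat) (l0 l : nat) (hl : (2 <= l)%N)
    (C : geometric_class) (hC : val C = code_word s k l0 l) :
  [/\ sorted <=%R (der C),
      forall i j : nat, (i < j <= s.+1)%N -> (Aseq k i < Aseq k j)%N,
      forall v : int, v \in der C <->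
        exists2 j : nat, (j <= s.+1)%N & v = (Aseq k j)%:Z
    & [/\ appears_in_a_row (Aseq k 0)%:Z (2 + k 0 + l0)%N (der C),
          forall j : nat, (1 <= j <= s)%N ->
            appears_in_a_row (Aseq k j)%:Z (1 + k j)%N (der C)
        & appears_in_a_row (Aseq k s.+1)%:Z (l - 1)%N (der C)]].
Proof.
pose c j :=
  (if j == 0 then 2 + k 0 + l0 else if j <= s then 1 + k j else l - 1)%N.
have A_lt : {homo (fun j => (Aseq k j)%:Z) : i j / (i < j)%N >-> i < j}.
  by move=> i j /(Aseq_lt k); rewrite ltz_nat.
have c0 : c 0%N = (2 + k 0 + l0)%N by [].
have c_mid j : (1 <= j <= s)%N -> c j = (1 + k j)%N.
  by rewrite /c; case: j => //= j ->.
have c_last : c s.+1 = (l - 1)%N by rewrite /c /= ltnn.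
rewrite (der_code_word hl hC c0 c_mid c_last).
split=> [|i j /andP[/(Aseq_lt k)] //|v|].
- exact: sorted_runs.
- split=> [/mem_runs[j /andP[_ ltj] [_ ->]]|[j lej ->]]; first by exists j.
  apply/mem_runs; exists j => //; split=> //.
  (* Every run is nonempty, the last one because [l] is at least 2. *)
  by rewrite /c; case: eqP => // _; case: ifP => // _; lia.
- split=> [|j /andP[j_gt0 lejs]|]; first by rewrite -c0; apply: runs_in_a_row.
    by rewrite -c_mid ?j_gt0 //; apply: runs_in_a_row => //; lia.
  by rewrite -c_last; apply: runs_in_a_row.
Qed.
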